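(* Let $L$ be a finite lattice with at least two elements. There exists $m \in \mathbf{N}$ such that for all $n \geq m$, $L$ has the $[n]$-density property.
   Context: $[n]$ is the $n$-element chain. For posets $P$ and $Q$, $Q^P$ is the set of order-preserving maps from $P$ to $Q$. For $a \in L$, $[a) = \{u \in L \mid u \geq a\}$. An element $a$ is join-irreducible iff $a = v \vee w$ implies $a = v$ or $a = w$. Let $P$ be a finite poset and $p$ the number of filters (up-closed subsets, including the empty one) of $P$; for $P=[n]$, $p = n+1$. $L$ has the $P$-density property iff there is a join-irreducible $a \in L$ with $\frac{|[a)^P|}{|L^P|} \leq \frac{1}{p}$. *)

(* Defs.v *)
From HB Require Import structures.
From mathcomp Require Import all_boot all_order all_algebra.

Set Implicit Arguments.
Unset Strict Implicit.
Unset Printing Implicit Defensive.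

Import Order.TTheory GRing.Theory Num.Theory.
Local Open Scope order_scope.

(* Q^P *)
Definition order_maps (dP dQ : Order.disp_t) (P : finPOrderType dP)
    (Q : finPOrderType dQ) : {set {ffun P -> Q}} :=
  [set f : {ffun P -> Q} | [forall x, forall y, (x <= y) ==> (f x <= f y)]].

(* [a) as a subtype of L, so that it is a poset for the order induced by L *)
Definition principal_filter (d : Order.disp_t) (L : finPOrderType d) (a : L) :=
  {u : L | a <= u}.

HB.instance Definition _ (d : Order.disp_t) (L : finPOrderType d) (a : L) :=
  SubType.on (principal_filter a).
HB.instance Definition _ (d : Order.disp_t) (L : finPOrderType d) (a : L) :=
  Finite.on (principal_filter a).
HB.instance Definition _ (d : Order.disp_t) (L : finPOrderType d) (a : L) :=
  [SubChoice_isSubPOrder of principal_filter a by <: with d].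

(* The bottom element satisfies this condition. *)
Definition join_irreducible (d : Order.disp_t) (L : finLatticeType d) (a : L) :
    Prop :=
  forall v w : L, a = v `|` w -> a = v \/ a = w.

Definition filters (d : Order.disp_t) (P : finPOrderType d) : {set {set P}} :=
  [set F : {set P} |
    [forall x, forall y, (x \in F) && (x <= y) ==> (y \in F)]].

Definition density_property (dP dL : Order.disp_t) (P : finPOrderType dP)
    (L : finLatticeType dL) : Prop :=
  exists2 a : L, join_irreducible a &
    (#|order_maps P (principal_filter a)|%:R / #|order_maps P L|%:R
      <= 1 / #|filters P|%:R :> rat)%R.

(* Main.v *)
(* Let [c_k(x)] be the number of strict chains [x < x_1 < ... < x_k], so that
   [[x)^[n]] has [\sum_k c_k(x) 'C(n, k)] elements.  Let [r] be the height of [L],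
   i.e. the largest [k] with [c_k(0) > 0], and [J] the set of nonzero
   join-irreducibles.  If some [a] in [J] satisfies [r c_{r-1}(a) < c_r(0)], then
   comparing leading terms gives the density inequality for large [n].  Otherwise,
   since [\sum_{a in J} c_{r-1}(a) <= c_r(0)], one has [#|J| <= r].  Along a
   longest chain the set of join-irreducibles below the current element grows
   strictly, so some [b] lies above all of [J] except one [a]; then [L] contains
   a copy of [[a) * [2]], which gives the inequality for every [P]. *)
Require Import Defs.
From mathcomp Require Import all_boot all_order all_algebra.
From mathcomp Require Import zify.

Set Implicit Arguments.
Unset Strict Implicit.
Unset Printing Implicit Defensive.

Import Order.TTheory GRing.Theory Num.Theory.
Local Open Scope order_scope.

(** * Growth of binomial sums *)

Lemma leq_bin_succ n k : (k.*2 < n)%N -> ('C(n, k) <= 'C(n, k.+1))%N.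
Proof.
move=> hk; rewrite -(leq_pmul2l (ltn0Sn k)) mul_bin_left leq_mul2r.
by apply/orP; right; lia.
Qed.

Lemma leq_bin_half n k s : (k <= s)%N -> (s.*2 <= n)%N -> ('C(n, k) <= 'C(n, s))%N.
Proof.
elim: s => [|s IH]; first by rewrite leqn0 => /eqP->.
rewrite leq_eqVlt => /orP[/eqP-> //|ks hs].
by apply: leq_trans (IH _ _) (leq_bin_succ _); lia.
Qed.

(** Here [n.+1 <= (n - k).*2], and [(n - k) * 'C(n, k) = k.+1 * 'C(n, k.+1)]; binomials increase up
    to the middle. *)
Lemma binomial_growth n k s :
  (k < s)%N -> (s.*2.+2 <= n)%N -> (n.+1 * 'C(n, k) <= s.+1.*2 * 'C(n, s))%N.
Proof.
move=> ks hn; apply: (@leq_trans ((n - k).*2 * 'C(n, k))).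
  by rewrite leq_mul2r; apply/orP; right; lia.
rewrite -doubleMl -mul_bin_left -!doubleMl leq_double.
by apply: leq_mul; [lia | apply: leq_bin_half; lia].
Qed.

(** Since [n.+1 * 'C(n, s)] is about [s.+1 * 'C(n, s.+1)], the strict hypothesis leaves a margin
    [(n - s) * 'C(n, s)], which absorbs all lower terms for large [n]. *)
Lemma binomial_sum_dominated (e c : nat -> nat) s :
  (forall k, (s < k)%N -> e k = 0%N) -> (s.+1 * e s < c s.+1)%N ->
  exists m, forall n, (m <= n)%N ->
    ((\sum_(k < n.+1) e k * 'C(n, k)) * n.+1
       <= \sum_(k < n.+1) c k * 'C(n, k))%N.
Proof.
move=> e0 ec; pose S := (\sum_(k < s) e k)%N.
(* The first two summands are what the margin must cover once [n.+1] is split as [(n - s) + s.+1];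
   the last one covers [s] and permits [binomial_growth]. *)
exists (s.+1 * s.+1.*2 * S + s.+1 * s.+1 * e s + s.+1.*2.+2)%N => n hn.
have hs : (s.+1 < n.+1)%N by lia.
apply: (@leq_trans (c s.+1 * 'C(n, s.+1))); last first.
  by rewrite (bigD1 (Ordinal hs)) //= leq_addr.
have -> : (\sum_(k < n.+1) e k * 'C(n, k) =
           \sum_(k < s) e k * 'C(n, k) + e s * 'C(n, s))%N.
  rewrite -(big_ord_recr s (fun k => e k * 'C(n, k))%N) /=.
  rewrite (@big_ord_widen _ _ _ s.+1 n.+1 (fun k => e k * 'C(n, k))%N); last lia.
  rewrite [RHS]big_mkcond; apply: eq_bigr => i _.
  by case: ltnP => // /e0->.
have low : ((\sum_(k < s) e k * 'C(n, k)) * n.+1 <= s.+1.*2 * S * 'C(n, s))%N.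
  rewrite big_distrl [X in (_ <= X * _)%N]big_distrr big_distrl /=.
  apply: leq_sum => k _.
  have := @binomial_growth n k s (ltn_ord k) ltac:(lia).
  by move/(leq_mul (leqnn (e k))); lia.
rewrite -(leq_pmul2l (ltn0Sn s)) [X in (_ <= X)%N]mulnCA mul_bin_left.
move: low; set T := (\sum_(k < s) _)%N; set B := 'C(n, s) => low.
have := leq_mul (leqnn s.+1) low.
suff : (s.+1 * s.+1.*2 * S * B + s.+1 * e s * n.+1 * B <= c s.+1 * (n - s) * B)%N.
  lia.
rewrite -mulnDl leq_mul2r; apply/orP; right.
apply: (@leq_trans ((s.+1 * e s).+1 * (n - s))); last by rewrite leq_mul2r ec orbT.
have -> : (n.+1 = (n - s) + s.+1)%N by lia.
lia.
Qed.

(** * Counting multichains by strict chains *)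

Section Multichains.
Variables (d : Order.disp_t) (L : finPOrderType d).

(* The number of strict chains [x < x_1 < ... < x_k]. *)
Fixpoint nchains (k : nat) (x : L) : nat :=
  if k is k'.+1 then \sum_(y | x < y) nchains k' y else 1.

(** Taken inside the maps to [L], so that the sets for different [a] share one type. *)
Definition multichains n (a : L) : {set {ffun 'I_n -> L}} :=
  [set f in order_maps 'I_n L | [forall i, a <= f i]].

Lemma order_mapsP (dP : Order.disp_t) (P : finPOrderType dP) (f : {ffun P -> L}) :
  reflect {homo f : x y / x <= y} (f \in order_maps P L).
Proof.
rewrite inE; apply: (iffP forallP) => [h x y xy | h x].
  by have /forallP/(_ y)/implyP := h x; apply.
by apply/forallP => y; apply/implyP; apply: h.
Qed.

Lemma multichainsP n a (f : {ffun 'I_n -> L}) :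
  reflect ({homo f : x y / x <= y} /\ forall i, a <= f i) (f \in multichains n a).
Proof.
rewrite inE; apply: (iffP andP) => [[/order_mapsP ? /forallP ?]|[? ?]]; split => //.
  exact/order_mapsP.
exact/forallP.
Qed.

Lemma card_multichains0 a : #|multichains 0 a| = 1%N.
Proof.
apply/eqP/cards1P; exists [ffun=> a]; apply/setP => f.
have -> : f = [ffun=> a] by apply/ffunP; case.
by rewrite set11; apply/multichainsP; split; case.
Qed.

Definition cons_ffun n (y : L) (g : {ffun 'I_n -> L}) : {ffun 'I_n.+1 -> L} :=
  [ffun i => oapp g y (unlift ord0 i)].

Lemma cons_ffun0 n y (g : {ffun 'I_n -> L}) : cons_ffun y g ord0 = y.
Proof. by rewrite ffunE unlift_none. Qed.

Lemma cons_ffun_lift n y (g : {ffun 'I_n -> L}) i :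
  cons_ffun y g (lift ord0 i) = g i.
Proof. by rewrite ffunE liftK. Qed.

Lemma cons_ffun_eta n (f : {ffun 'I_n.+1 -> L}) :
  cons_ffun (f ord0) [ffun i => f (lift ord0 i)] = f.
Proof.
apply/ffunP => i; case: (unliftP ord0 i) => [j|] ->.
  by rewrite cons_ffun_lift ffunE.
by rewrite cons_ffun0.
Qed.

Lemma cons_multichains n a y (g : {ffun 'I_n -> L}) :
  (cons_ffun y g \in multichains n.+1 a) = (a <= y) && (g \in multichains n y).
Proof.
apply/multichainsP/andP => [[hm ha]|[ay /multichainsP[hm hy]]].
  split; first by rewrite -(cons_ffun0 y g).
  apply/multichainsP; split => [i j ij|i].
    by rewrite -!(cons_ffun_lift y g) hm // leEord !lift0 ltnS -leEord.
  by rewrite -(cons_ffun_lift y g) -{1}(cons_ffun0 y g) hm // leEord.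
split => [i j|i]; last first.
  case: (unliftP ord0 i) => [i'|] ->; last by rewrite cons_ffun0.
  by rewrite cons_ffun_lift (le_trans ay).
case: (unliftP ord0 i) => [i'|] ->; case: (unliftP ord0 j) => [j'|] ->;
  rewrite ?cons_ffun_lift ?cons_ffun0 //.
by rewrite leEord !lift0 ltnS => ?; apply: hm.
Qed.

Lemma card_multichainsS n a :
  #|multichains n.+1 a| = \sum_(y | a <= y) #|multichains n y|.
Proof.
rewrite -sum1_card (partition_big (fun f : {ffun 'I_n.+1 -> L} => f ord0)
  (fun y : L => a <= y)) /=; last by move=> f /multichainsP[_]; apply.
apply: eq_bigr => y ay; rewrite sum1dep_card -[RHS](card_imset _ (f := @cons_ffun n y)).
  apply: eq_card => f; rewrite inE; apply/andP/imsetP => [[fm /eqP fy]|[g gm ->]].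
    exists [ffun i => f (lift ord0 i)]; last by rewrite -fy cons_ffun_eta.
    by move: fm; rewrite -{1}(cons_ffun_eta f) cons_multichains fy => /andP[].
  by rewrite cons_multichains ay gm cons_ffun0.
by move=> g g' eg; apply/ffunP => i; rewrite -(cons_ffun_lift y) eg cons_ffun_lift.
Qed.

(** Choose the [k] positions where the value jumps, the first jump being from [a]. In the induction,
    the first value [a] and the first values above [a] give the two terms of Pascal's rule. *)
Lemma card_multichains n a :
  #|multichains n a| = (\sum_(k < n.+1) nchains k a * 'C(n, k))%N.
Proof.
elim: n a => [|n IH] a; first by rewrite card_multichains0 big_ord1 bin0.
rewrite card_multichainsS (bigD1 a) //= IH.
under eq_bigl do rewrite andbC eq_sym -lt_neqAle.
under eq_bigr do rewrite IH.
rewrite exchange_big big_ord_recl [RHS]big_ord_recl /= !bin0 -addnA; congr addn.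
under [in RHS]eq_bigr => i _ do rewrite /bump /= add1n binS mulnDr.
rewrite big_split /=; congr addn.
  rewrite big_ord_recr /= bin_small ?muln0 ?addn0 //.
by apply: eq_bigr => i _; rewrite big_distrl.
Qed.

Lemma card_filter_maps n a :
  #|order_maps 'I_n (principal_filter a)| = #|multichains n a|.
Proof.
pose h (f : {ffun 'I_n -> principal_filter a}) := [ffun i => val (f i)].
have h_inj : injective h.
  by move=> f g /ffunP fg; apply/ffunP => i; apply: val_inj; have := fg i; rewrite !ffunE.
rewrite -(card_imset _ h_inj); apply: eq_card => g.
apply/imsetP/multichainsP => [[f]|[gm ga]].
  rewrite inE => /forallP fm ->; split => [i j ij|i]; last by rewrite ffunE (valP (f i)).
  by rewrite !ffunE; have /forallP/(_ j) := fm i; rewrite ij.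
exists [ffun i => Sub (g i) (ga i) : principal_filter a].
  rewrite inE; apply/forallP => i; apply/forallP => j; apply/implyP => ij.
  by rewrite !ffunE leEsub /= gm.
by apply/ffunP => i; rewrite !ffunE.
Qed.

End Multichains.

(** * Filters of a chain; the inequality without fractions *)

(** Filters of a chain are nested, so their sizes, at most [n], tell them apart. *)
Lemma card_filters_ord n : (#|filters 'I_n| <= n.+1)%N.
Proof.
have sub_total (F G : {set 'I_n}) : F \in filters 'I_n -> G \in filters 'I_n ->
    (F \subset G) || (G \subset F).
  rewrite !inE => /forallP hF /forallP hG; case: (boolP (F \subset G)) => //=.
  case/subsetPn => x xF xG; apply/subsetP => y yG.
  have [xy|yx] := leP x y; first by have /forallP/(_ y) := hF x; rewrite xF xy.
  by have /forallP/(_ x) := hG y; rewrite yG (ltW yx) (negbTE xG).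
pose c (F : {set 'I_n}) : 'I_n.+1 := inord #|F|.
have cE F : c F = #|F| :> nat.
  by rewrite inordK // ltnS -[X in (_ <= X)%N](card_ord n) max_card.
rewrite -[X in (_ <= X)%N](card_ord n.+1) -(card_in_imset (f := c)) ?max_card //.
move=> F G hF hG /(congr1 val); rewrite /= !cE => FG.
case/orP: (sub_total F G hF hG) => s; apply/eqP.
  by rewrite eqEcard s FG leqnn.
by rewrite eq_sym eqEcard s FG leqnn.
Qed.

Lemma density_propertyI (dP dL : Order.disp_t) (P : finPOrderType dP)
    (L : finLatticeType dL) (a : L) : join_irreducible a ->
  (#|order_maps P (principal_filter a)| * #|filters P| <= #|order_maps P L|)%N ->
  density_property P L.
Proof.
move=> ja h; exists a => //.
have L0 : (0 < #|order_maps P L|)%N.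
  apply/card_gt0P; exists [ffun=> a].
  by apply/order_mapsP => x y; rewrite !ffunE.
have F0 : (0 < #|filters P|)%N.
  apply/card_gt0P; exists set0; rewrite inE.
  by apply/forallP => x; apply/forallP => y; rewrite !inE.
by rewrite ler_pdivrMr ?ltr0n // mulrAC mul1r ler_pdivlMr ?ltr0n // -natrM ler_nat.
Qed.

(** * Join-irreducibles below an element *)

Section JoinIrreducibles.
Variables (d : Order.disp_t) (L : finLatticeType d).

(** With [o] the bottom, these are the nonzero join-irreducibles; [join_irreducible] alone admits
    [o]. *)
Definition joinirr (o : L) : {set L} :=
  [set a | (a != o) && [forall v, forall w, (a == v `|` w) ==> (a == v) || (a == w)]].

Definition joinirr_below (o x : L) : {set L} := [set a in joinirr o | a <= x].

Lemma in_joinirr_below o x a :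
  (a \in joinirr_below o x) = (a \in joinirr o) && (a <= x).
Proof. by rewrite in_set. Qed.

Lemma finlattice_bottom : (0 < #|L|)%N -> exists o : L, forall x, o <= x.
Proof.
case/card_gt0P => x0 _.
have [o _ omin] := arg_minnP (fun x : L => #|[set y | y <= x]|) (isT : xpredT x0).
exists o => x; have := omin (o `&` x) isT; rewrite leqNgt => h.
apply/negP => nox; case/negP: h; apply: proper_card; apply/properP; split.
  by apply/subsetP => y; rewrite !inE lexI => /andP[].
by exists o; rewrite !inE ?lexI ?lexx /=; apply/negP.
Qed.

Variables (o : L) (le0 : forall x, o <= x).

Lemma joinirrP a : a \in joinirr o -> join_irreducible a.
Proof.
rewrite inE => /andP[_ /forallP h] v w /eqP e.
by have /forallP/(_ w)/implyP/(_ e)/orP[] := h v => /eqP; [left | right].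
Qed.

(** Every element is the join of the join-irreducibles below it: by induction on the size of the
    down-set, a reducible [x] is a join of two smaller elements. *)
Lemma joinirr_below_sub x y : (joinirr_below o x \subset joinirr_below o y) = (x <= y).
Proof.
apply/idP/idP => [|xy]; last first.
  by apply/subsetP => a; rewrite !inE => /andP[-> /le_trans->].
have [n] := ubnP #|[set z | z <= x]|; elim: n x => // n IH x.
rewrite ltnS => hx /subsetP sub.
have [xo|xo] := eqVneq x o; first by rewrite xo.
have [xj|] := boolP (x \in joinirr o).
  have : x \in joinirr_below o x by rewrite inE xj /=.
  by move/sub; rewrite inE => /andP[].
rewrite inE xo /= => /forallPn[v] /forallPn[w].
rewrite negb_imply negb_or => /and3P[/eqP xE xv xw].
have below z : z <= x -> x != z -> z <= y.
  move=> zx xz; apply: IH; last first.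
    by apply/subsetP => a; rewrite inE => /andP[aj az]; apply: sub; rewrite inE aj (le_trans az).
  apply: leq_trans hx; apply: proper_card; apply/properP; split.
    by apply/subsetP => u; rewrite !inE => /le_trans->.
  exists x; rewrite !inE //; apply/negP => xz'.
  by case/negP: xz; rewrite eq_le xz' zx.
by rewrite xE leUx !below // xE ?leUl ?leUr.
Qed.

Lemma joinirr_below_proper x y : x < y -> (#|joinirr_below o x| < #|joinirr_below o y|)%N.
Proof.
by move=> xy; apply: proper_card; rewrite properE !joinirr_below_sub (ltW xy) lt_geF.
Qed.

Lemma joinirr_below_le x : (#|joinirr_below o x| <= #|joinirr o|)%N.
Proof. by apply/subset_leq_card/subsetP => a; rewrite inE => /andP[]. Qed.

Lemma nchainsS_gt0 k (x : L) :
  (0 < nchains k.+1 x)%N -> exists2 y, x < y & (0 < nchains k y)%N.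
Proof.
rewrite lt0n sum_nat_eq0 => /forallPn[y].
by rewrite negb_imply -lt0n => /andP[]; exists y.
Qed.

(** Take for [b] the last but one element of a chain: each of the [k] steps up to [b] gains a
    join-irreducible, and the final step shows that [b] misses one. *)
Lemma nchains_joinirr k (x : L) : (0 < nchains k.+1 x)%N ->
  exists2 b, (k + #|joinirr_below o x| <= #|joinirr_below o b|)%N
           & (#|joinirr_below o b| < #|joinirr o|)%N.
Proof.
elim: k x => [|k IH] x /nchainsS_gt0[y /joinirr_below_proper xy hy].
  by exists x => //; apply: leq_trans xy (joinirr_below_le y).
by have [b hb ?] := IH _ hy; exists b => //; apply: leq_trans hb; lia.
Qed.

(* If [b] misses exactly one join-irreducible [a], then [x |-> x `&` b] embeds
   [[a)] into the elements not above [a], so that [L] contains a copy of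
   [[a) * [2]]. *)
Lemma density_of_coatom (dP : Order.disp_t) (P : finPOrderType dP) (b : L) :
  (#|joinirr_below o b|.+1 = #|joinirr o|)%N -> density_property P L.
Proof.
move=> hb.
have sub : joinirr_below o b \subset joinirr o.
  by apply/subsetP => a; rewrite inE => /andP[].
have /eqP/cards1P[a aE] : #|joinirr o :\: joinirr_below o b| = 1%N.
  by rewrite cardsD (setIidPr sub); lia.
have [ab aj] : ~~ (a <= b) /\ a \in joinirr o.
  have : a \in joinirr o :\: joinirr_below o b by rewrite aE set11.
  by rewrite in_setD [a \in joinirr_below o b]inE => /andP[/[swap] ->].
have jb c : c \in joinirr o -> c != a -> c <= b.
  move=> cj; apply: contraNT => cb; rewrite -in_set1 -aE in_setD cj andbT.
  by rewrite [c \in _]inE cj.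
(* Meeting with [b] loses only the join-irreducible [a], so on [[a)] it reflects the order. *)
have refl x y : a <= y -> x `&` b <= y -> x <= y.
  move=> ay xy; rewrite -joinirr_below_sub; apply/subsetP => c.
  rewrite !in_joinirr_below => /andP[cj cx]; rewrite cj /=.
  have [->//|ca] := eqVneq c a.
  by apply: le_trans xy; rewrite lexI cx jb.
apply: (density_propertyI (a := a)); first exact: joinirrP.
(* A filter is a monotone map to [[2]]: it selects the points where the value stays in [[a)]. *)
pose h (u : {ffun P -> principal_filter a} * {set P}) : {ffun P -> L} :=
  [ffun x => if x \in u.2 then val (u.1 x) else val (u.1 x) `&` b].
rewrite -cardsX -(card_in_imset (f := h)).
  apply/subset_leq_card/subsetP => _ /imsetP[[f F] /setXP[/= hf hF] ->].
  apply/order_mapsP => x y xy; rewrite !ffunE /=.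
  have fxy : val (f x) <= val (f y) by move/order_mapsP: hf; apply.
  move: hF; rewrite inE => /forallP/(_ x)/forallP/(_ y); rewrite xy andbT.
  case: (x \in F) => /=; first by move=> ->.
  case: (y \in F) => _; first by rewrite leIxl.
  by rewrite leI2.
case=> f F [g G] _ _ /ffunP e.
(* The filter is recovered as the set of points with image above [a], because [a] is not below
   [b]. *)
have FG : F = G.
  apply/setP => x; have := e x; rewrite !ffunE /=.
  case: (x \in F); case: (x \in G) => // E; case/negP: ab.
    by apply: le_trans (valP (f x)) _; rewrite /= E leIr.
  by apply: le_trans (valP (g x)) _; rewrite /= -E leIr.
rewrite -FG in e *; congr pair; apply/ffunP => x; apply: val_inj.
have := e x; rewrite !ffunE /=; case: ifP => // _ E.
apply/eqP; rewrite eq_le; apply/andP; split; apply: refl; try exact: valP.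
  by rewrite /= E leIl.
by rewrite /= -E leIl.
Qed.

End JoinIrreducibles.

(** * Comparing chain counts at the height of the lattice *)

Theorem theorem4p9p1 (d : Order.disp_t) (L : finLatticeType d)
    (hL : (2 <= #|L|)%N) :
  exists m : nat, forall n : nat, (m <= n)%N -> density_property 'I_n L.
Proof.
have [o le0] := finlattice_bottom (ltnW hL).
have gto x : x != o -> o < x by rewrite lt_neqAle eq_sym le0 andbT.
have bound k : (0 < nchains k o)%N -> (k <= #|joinirr o|)%N.
  by case: k => // k /(nchains_joinirr le0)[b]; lia.
have c0 : exists k, (0 < nchains k o)%N by exists 0.
case: (ex_maxnP c0 bound) => -[|s] cs smax.
  have : (0 < nchains 1 o)%N; last by move/smax.
  have [x xo] : exists x, x != o.
    apply/existsP; rewrite -negb_forall; apply: contraL hL => /forallP h.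
    rewrite -ltnNge ltnS -(cards1 o) -cardsT; apply/subset_leq_card/subsetP => x _.
    by rewrite inE; apply: h.
  by rewrite /= sum1_card; apply/card_gt0P; exists x; apply: gto.
have [/existsP[a /andP[aj ha]]|] :=
    boolP [exists a in joinirr o, (s.+1 * nchains s a < nchains s.+1 o)%N].
  have [m hm] : exists m, forall n, (m <= n)%N ->
      (#|multichains n a| * n.+1 <= #|multichains n o|)%N.
    have [k sk|m hm] :=
        @binomial_sum_dominated (fun k => nchains k a) (fun k => nchains k o) s _ ha.
      (* A longer chain from [a], prefixed by [o], would exceed the height [s.+1]. *)
      apply/eqP; rewrite -leqn0 leqNgt; apply/negP => ka.
      have : (0 < nchains k.+1 o)%N; last by move/smax; lia.
      apply: leq_trans ka _; rewrite /= (bigD1 a) ?leq_addr //.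
      by apply: gto; move: aj; rewrite inE => /andP[].
    by exists m => n /hm; rewrite !card_multichains.
  exists m => n mn; apply: (density_propertyI (joinirrP aj)).
  rewrite card_filter_maps; apply: leq_trans (leq_mul (leqnn _) (card_filters_ord n)) _.
  apply: leq_trans (hm n mn) (subset_leq_card _).
  by apply/subsetP => f; rewrite inE => /andP[].
rewrite negb_exists => /forallP hbig.
(* Longest chains from [o] whose first step is join-irreducible number at most [nchains s.+1 o]; sum
   the failed inequalities over [joinirr o] and cancel this count. *)
have Js : (#|joinirr o| <= s.+1)%N.
  rewrite -(leq_pmul2r cs) -sum_nat_const.
  apply: (@leq_trans (\sum_(a in joinirr o) s.+1 * nchains s a)).
    by apply: leq_sum => a aj; have := hbig a; rewrite aj /= -leqNgt.
  rewrite -big_distrr /= leq_mul2l [X in (_ <= X)%N](bigID [in joinirr o]) /=.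
  apply: leq_trans (leq_addr _ _); rewrite leq_eqVlt; apply/orP; left; apply/eqP.
  apply: eq_bigl => a; rewrite andbC inE; case: eqVneq => //= ao.
  by rewrite gto // andbT.
(* Now [s <= #|joinirr_below o b| < #|joinirr o| <= s.+1], so [b] misses exactly one. *)
have [b bl bu] := nchains_joinirr le0 cs.
by exists 0 => n _; apply: (@density_of_coatom _ _ _ le0 _ 'I_n b); lia.
Qed.
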